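(* Let $n\in\mathbb N_0$, $q\in\mathbb N_1$, $\theta>0$, and let $\nu$ be a Borel probability measure on $\Delta^{q-1}$. Then $\mathscr E^n_{\theta,\nu}$ is a probability distribution on $\mathcal A^{(q)}_n$, and its push-forward under the map $\mathsf{shape}$ is the Ewens Sampling Formula with parameter $\theta$: $$\mathsf{shape}_\sharp\,\mathscr E^n_{\theta,\nu}=E^n_\theta.$$
   Context: Notation: $\mathbb N_1=\{1,2,\dots\}$, $\mathbb N_0=\{0,1,\dots\}$, $\mathbb N^q_*=\mathbb N_0^q\setminus\{\mathbf 0\}$, $0^0=1$; $|\mathbf a|=\sum_ja_j$, $\mathbf u^{\mathbf a}=\prod_ju_j^{a_j}$, $\binom{|\mathbf a|}{\mathbf a}=|\mathbf a|!/\prod_ja_j!$; $\Delta^{q-1}=\{\mathbf u\in[0,1]^q:|\mathbf u|=1\}$; $\langle\theta\rangle_n=\theta(\theta+1)\cdots(\theta+n-1)$; $m_{\mathbf a}(\nu)=\int_{\Delta^{q-1}}\mathbf u^{\mathbf a}\,d\nu(\mathbf u)$. A $q$-chromatic partition of $n$ is a finitely supported map $A\colon\mathbb N^q_*\to\mathbb N_0$ with $\sum_{\mathbf a}A(\mathbf a)|\mathbf a|=n$; $\mathcal A^{(q)}_n$ is the set of these. An integer partition of $n$ is $\boldsymbol\lambda=(\lambda_1,\dots,\lambda_n)\in\mathbb N_0^n$ with $\sum_ii\lambda_i=n$ (written $\boldsymbol\lambda\vdash n$). The shape of $A\in\mathcal A^{(q)}_n$ is the integer partition with $\mathsf{shape}(A)_i=\sum_{\mathbf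 a\in\mathrm{supp}A:|\mathbf a|=i}A(\mathbf a)$. Ewens Sampling Formula: $E^n_\theta[\boldsymbol\lambda]=\frac{n!}{\langle\theta\rangle_n}\prod_{i=1}^n\frac{\theta^{\lambda_i}}{i^{\lambda_i}\lambda_i!}$, $\boldsymbol\lambda\vdash n$. Polychromatic Ewens Sampling Formula: $$\mathscr E^n_{\theta,\nu}[A]=\frac{n!}{\langle\theta\rangle_n}\prod_{\mathbf a\in\mathrm{supp}A}\frac1{A(\mathbf a)!}\Big(\frac{\theta}{|\mathbf a|}\binom{|\mathbf a|}{\mathbf a}m_{\mathbf a}(\nu)\Big)^{A(\mathbf a)},\qquad A\in\mathcal A^{(q)}_n.$$ *)

(* Defs.v *)
From HB Require Import structures.
From mathcomp Require Import all_boot all_order all_algebra finmap.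
From mathcomp Require Import all_classical all_reals all_analysis.

Set Implicit Arguments.
Unset Strict Implicit.
Unset Printing Implicit Defensive.
Import Order.TTheory GRing.Theory Num.Theory.
Import numFieldNormedType.Exports.

Local Open Scope classical_set_scope.
Local Open Scope ring_scope.

Definition simplex (R : realType) (q : nat) : set 'rV[R]_q :=
  [set u | (forall j, 0 <= u 0 j <= 1) /\ \sum_j u 0 j = 1].
Arguments simplex : clear implicits.

Section Vertex.
Variables (R : realType) (q : nat) (q_gt0 : (0 < q)%N).

Let vertex : 'rV[R]_q := delta_mx 0 (Ordinal q_gt0).

Lemma vertex_simplex : vertex \in simplex R q.
Proof.
apply/mem_set; split=> [j|].
  by rewrite mxE ler0n lern1 leq_b1.
rewrite (bigD1 (Ordinal q_gt0)) //= mxE !eqxx big1 ?addr0 // => j jq.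
by rewrite mxE (negPf jq) andbF.
Qed.

End Vertex.

(* A measurableType must be pointed, hence the argument q_gt0. The
   topology is the one induced by 'rV[R]_q. *)
Definition simplex_space (R : realType) (q : nat) (q_gt0 : (0 < q)%N) : Type :=
  set_type (simplex R q).

HB.instance Definition _ R q (q_gt0 : (0 < q)%N) :=
  Topological.copy (simplex_space R q_gt0) (set_type (simplex R q)).
HB.instance Definition _ R q (q_gt0 : (0 < q)%N) :=
  isPointed.Build (simplex_space R q_gt0)
    (exist (fun u => u \in simplex R q) _ (vertex_simplex R q_gt0)).

Definition borel_simplex (R : realType) (q : nat) (q_gt0 : (0 < q)%N) :=
  g_sigma_algebraType (@open (simplex_space R q_gt0)).

Definition multi_index (q : nat) : Type := {ffun 'I_q -> nat}.
HB.instance Definition _ q := Choice.on (multi_index q).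

Definition nz_multi_index (q : nat) : Type :=
  {a : multi_index q | a != [ffun=> 0%N]}.
HB.instance Definition _ q := Choice.on (nz_multi_index q).

Definition weight (q : nat) (a : multi_index q) : nat := (\sum_j a j)%N.

Definition multinomial (R : realType) (q : nat) (a : multi_index q) : R :=
  (weight a)`!%:R / \prod_j (a j)`!%:R.

Definition moment (R : realType) (q : nat) (q_gt0 : (0 < q)%N)
    (nu : probability (borel_simplex R q_gt0) R) (a : multi_index q) : R :=
  \int[nu]_(u in [set: borel_simplex R q_gt0]) \prod_j (val u) 0 j ^+ a j.

Definition rising (R : realType) (theta : R) (n : nat) : R :=
  \prod_(i < n) (theta + i%:R).

Definition chromatic_map (q : nat) : Type :=
  {fsfun nz_multi_index q -> nat with 0%N}.
HB.instance Definition _ q := Choice.on (chromatic_map q).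

Definition chromatic_total (q : nat) (A : chromatic_map q) : nat :=
  (\sum_(a <- finsupp A) A a * weight (val a))%N.

Definition chromatic_partition (q n : nat) : Type :=
  {A : chromatic_map q | chromatic_total A == n}.
HB.instance Definition _ q n := Choice.on (chromatic_partition q n).

(* The entry of index i : 'I_n is the multiplicity lambda_(i+1) of the part
   i+1. *)
Definition int_partition (n : nat) : Type :=
  {l : {ffun 'I_n -> nat} | (\sum_(i < n) i.+1 * l i == n)%N}.
HB.instance Definition _ n := Choice.on (int_partition n).

Definition shape_fun (q n : nat) (A : chromatic_map q) : {ffun 'I_n -> nat} :=
  [ffun i : 'I_n =>
     (\sum_(a <- finsupp A | weight (val a) == i.+1) A a)%N].

Lemma weight_gt0 (q : nat) (a : nz_multi_index q) : (0 < weight (val a))%N.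
Proof.
rewrite lt0n; apply: contra (valP a); rewrite sum_nat_eq0 => /forallP a0.
by apply/eqP/ffunP => j; rewrite ffunE; apply/eqP/a0.
Qed.

Lemma shape_subproof (q n : nat) (A : chromatic_partition q n) :
  (\sum_(i < n) i.+1 * shape_fun n (val A) i == n)%N.
Proof.
case: A => A /= wA; rewrite -[X in _ == X](eqP wA) /chromatic_total.
apply/eqP.
under eq_bigr => i _ do rewrite ffunE big_distrr big_mkcond /=.
rewrite exchange_big /= [LHS]big_seq_cond [RHS]big_seq_cond.
apply: eq_bigr => a /andP[asupp _].
have lt_an : ((weight (val a)).-1 < n)%N.
  rewrite prednK ?weight_gt0 // -(eqP wA) /chromatic_total.
  rewrite (big_fsetD1 a) //= (leq_trans _ (leq_addr _ _)) // leq_pmull //.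
  by rewrite lt0n -mem_finsupp.
rewrite (bigD1 (Ordinal lt_an)) //= prednK ?weight_gt0 // eqxx big1 ?addn0.
  by rewrite mulnC.
move=> i; rewrite -val_eqE /= => ia; case: eqP => // ai.
by rewrite ai /= eqxx in ia.
Qed.

Definition chromatic_shape (q n : nat) (A : chromatic_partition q n) :
    int_partition n :=
  exist (fun l : {ffun 'I_n -> nat} => \sum_(i < n) i.+1 * l i == n)%N
    (shape_fun n (val A)) (shape_subproof A).

Definition ESF (R : realType) (n : nat) (theta : R) (l : int_partition n) : R :=
  n`!%:R / rising theta n *
  \prod_(i < n) (theta ^+ val l i / (i.+1%:R ^+ val l i * (val l i)`!%:R)).

Definition polyESF (R : realType) (n q : nat) (q_gt0 : (0 < q)%N) (theta : R)
    (nu : probability (borel_simplex R q_gt0) R)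
    (A : chromatic_partition q n) : R :=
  n`!%:R / rising theta n *
  \prod_(a <- finsupp (val A))
    ((val A a)`!%:R^-1 *
     (theta / (weight (val a))%:R * multinomial R (val a) * moment nu (val a))
       ^+ val A a).

Arguments ESF {R} n theta l.
Arguments polyESF {R} n {q q_gt0} theta nu A.

(* The measure on the discrete space T with mass function p >= 0. *)
Definition mass_measure (R : realType) (T : choiceType) (p : T -> R)
    (B : set T) : \bar R :=
  (\esum_(x in B) (p x)%:E)%E.

Definition is_distribution (R : realType) (T : choiceType) (p : T -> R) : Prop :=
  (forall x, 0 <= p x) /\ mass_measure p [set: T] = 1%E.

(* Main.v *)
Require Import Defs.
From mathcomp Require Import all_boot all_order all_algebra finmap.
From mathcomp Require Import all_classical all_reals all_analysis.
From mathcomp Require Import measurable_realfun ring.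

(** Up to the factor n! / rising theta n, the polychromatic formula gives a
    partition A the weight prod_a x_a^A(a) / A(a)!, the weight of independent
    Poisson multiplicities of means x_a = theta / |a| * multinomial(a) *
    m_a(nu); the Ewens formula has the same form with means theta / i.  Taking
    the shape merges all the colors a with |a| = i into one part size.  Since a
    sum of independent Poisson variables is Poisson with the sum of the means
    ([sum_grouped]), the fiber of the shape map over l has the Poisson weight
    of l for the merged means sum_(|a| = i) x_a.  By the multinomial theorem
    sum_(|a| = i) multinomial(a) u^a = (sum_j u_j)^i = 1 on the simplex, and
    integrating against nu shows that the merged means are exactly theta / i
    ([sum_color_weight]).  Every fiber thus has the Ewens mass of its base
    point ([mass_shape_fiber]), which gives the push-forward; the total mass is
    then that of the Ewens formula, which is 1 because the partitions of m have
    total Poisson weight rising theta m / m! ([sum_partition_weight]).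

    The three summations (multinomial theorem, merging, Ewens normalization)
    all follow from one identity, [sum_multiplicity]: weighting each f by its
    multiplicity f i amounts to multiplying by x i and lowering f i by one.
    Summing it with suitable coefficients yields a recursion for each of the
    sums at hand. *)

Set Implicit Arguments.
Unset Strict Implicit.
Unset Printing Implicit Defensive.
Import Order.TTheory GRing.Theory Num.Theory.
Import numFieldNormedType.Exports.

Local Open Scope classical_set_scope.
Local Open Scope ring_scope.

(** * Sums of Poisson weights over families of multiplicities *)

Section Multiplicities.
Variables (R : realType) (I : finType).
Implicit Types (x : I -> R) (f g : {ffun I -> nat}) (Q : set {ffun I -> nat}).

(** Up to the factor exp (- sum x), the joint mass function of independent
    Poisson variables of means x i. *)
Definition poisson_weight x f : R := \prod_i (x i ^+ f i / (f i)`!%:R).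

Definition incr i f : {ffun I -> nat} := [ffun j => (f j + (j == i))%N].

Lemma incr_inj i : injective (incr i).
Proof.
move=> f g /ffunP fg; apply/ffunP => j.
by have := fg j; rewrite !ffunE => /addIn.
Qed.

Lemma poisson_weight_ge0 x f :
  (forall i, 0 <= x i) -> 0 <= poisson_weight x f.
Proof.
by move=> x0; apply: prodr_ge0 => i _; rewrite divr_ge0 ?exprn_ge0 ?ler0n.
Qed.

Lemma finite_bounded Q N : (forall f i, Q f -> (f i <= N)%N) -> finite_set Q.
Proof.
move=> QN; pose h (f : {ffun I -> 'I_N.+1}) := [ffun i => f i : nat].
apply: (@sub_finite_set _ _ (h @` setT)); last exact/finite_image/finite_finset.
move=> f Qf; exists [ffun i => inord (f i)] => //.
by apply/ffunP => i; rewrite !ffunE inordK // ltnS QN.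
Qed.

Lemma poisson_weight_incr x i f :
  (incr i f i)%:R * poisson_weight x (incr i f) = x i * poisson_weight x f.
Proof.
rewrite /poisson_weight (bigD1 i) //= [in RHS](bigD1 i) //= !mulrA.
congr (_ * _); last first.
  by apply: eq_bigr => j /negPf ji; rewrite ffunE ji addn0.
rewrite ffunE eqxx addn1 factS exprS natrM.
have : (f i).+1%:R != 0 :> R by rewrite pnatr_eq0.
have : (f i)`!%:R != 0 :> R by rewrite pnatr_eq0 -lt0n fact_gt0.
by move=> f0 f1; field; rewrite f0 nat1r f1.
Qed.

(** The size-biasing (Mecke) identity of Poisson variables: the terms with
    f i = 0 vanish, and the other ones are reindexed by f = incr i g. *)
Lemma sum_multiplicity x Q i :
  \sum_(f \in Q) ((f i)%:R * poisson_weight x f) =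
  x i * \sum_(g \in [set g | Q (incr i g)]) poisson_weight x g.
Proof.
rewrite mulr_fsumr; under [RHS]eq_fsbigr do rewrite -poisson_weight_incr.
rewrite -(@fsbig_image _ _ _ _ _ [set g | Q (incr i g)] (incr i)
  (fun f => (f i)%:R * poisson_weight x f)); last first.
  by move=> f g _ _; exact: incr_inj.
apply/esym/fsbig_widen => [_ [g Qg <-] //|f [/= Qf fN]].
have [->|fi0] := posnP (f i); first by rewrite mul0r.
case: fN; exists [ffun j => (f j - (j == i))%N]; last first.
  apply/ffunP => j; rewrite !ffunE subnK //.
  by case: eqP => // ->.
rewrite /= (_ : incr _ _ = f) //.
apply/ffunP => j; rewrite !ffunE subnK //.
by case: eqP => // ->.
Qed.

(** When the constraint Q fixes the linear statistic sum_i c i * f i, the left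
    side is a multiple of the weight of Q, and this becomes a recursion. *)
Lemma sum_linear_multiplicity x Q (c : I -> nat) : finite_set Q ->
  \sum_(f \in Q) ((\sum_i c i * f i)%N%:R * poisson_weight x f) =
  \sum_i (c i)%:R * x i * \sum_(g \in [set g | Q (incr i g)]) poisson_weight x g.
Proof.
move=> finQ; under [RHS]eq_bigr do rewrite -mulrA -sum_multiplicity mulr_fsumr.
rewrite [LHS]fsbig_finite //.
under [RHS]eq_bigr do rewrite fsbig_finite //.
rewrite [RHS]exchange_big /=; apply: eq_bigr => f _.
by rewrite natr_sum mulr_suml; apply: eq_bigr => i _; rewrite natrM mulrA.
Qed.

End Multiplicities.

(** * Merging multiplicities along a map, and the multinomial theorem *)

Section Grouping.
Variables (R : realType) (I K : finType) (kappa : I -> K) (x : I -> R).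

Definition grouped (l : {ffun K -> nat}) : set {ffun I -> nat} :=
  [set f | forall k, (\sum_(i | kappa i == k) f i = l k)%N].

Lemma finite_grouped l : finite_set (grouped l).
Proof.
apply: (@finite_bounded _ _ (\max_k l k)) => f i lf.
apply: leq_trans (leq_bigmax (kappa i)); rewrite -(lf (kappa i)).
by rewrite (bigD1 i) //= leq_addr.
Qed.

Lemma grouped_incr k l i : kappa i = k ->
  [set g | grouped (incr k l) (incr i g)] = grouped l.
Proof.
move=> ik.
have E g k' : (\sum_(j | kappa j == k') incr i g j =
    \sum_(j | kappa j == k') g j + (k' == k))%N.
  under eq_bigr do rewrite ffunE.
  rewrite big_split /=; congr (_ + _)%N.
  have [->|k'k] := eqVneq k' k.
    by rewrite (bigD1 i) ?ik ?eqxx //= big1 // => j /andP[_ /negPf ->].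
  rewrite big1 // => j /eqP jk'; have [ji|//] := eqVneq j i.
  by rewrite -jk' ji ik eqxx in k'k.
apply/seteqP; split => g /= gl k'; have := gl k'; rewrite E ffunE.
  by move/addIn.
by move=> ->.
Qed.

(** The statistic to apply [sum_linear_multiplicity] to is the number of items
    in class k, which is constant on the family. *)
Lemma sum_grouped_incr k (l : {ffun K -> nat}) :
  (l k).+1%:R * \sum_(f \in grouped (incr k l)) poisson_weight x f =
  (\sum_(i | kappa i == k) x i) * \sum_(f \in grouped l) poisson_weight x f.
Proof.
rewrite mulr_fsumr.
transitivity (\sum_(f \in grouped (incr k l))
    ((\sum_i (kappa i == k) * f i)%N%:R * poisson_weight x f)).
  apply: eq_fsbigr => f; rewrite inE => lf; congr (_%:R * _).
  have := lf k; rewrite ffunE eqxx addn1 => <-.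
  by rewrite big_mkcond; apply: eq_bigr => i _; case: eqP; rewrite ?mul1n.
rewrite sum_linear_multiplicity; last exact: finite_grouped.
rewrite mulr_suml [RHS]big_mkcond; apply: eq_bigr => i _.
case: eqP => ik; last by rewrite !mul0r.
by rewrite mul1r grouped_incr.
Qed.

(** A sum of independent Poisson variables is Poisson: both sides satisfy the
    recursion of [sum_grouped_incr] and agree at l = 0. *)
Lemma sum_grouped (l : {ffun K -> nat}) :
  \sum_(f \in grouped l) poisson_weight x f =
  poisson_weight (fun k => \sum_(i | kappa i == k) x i) l.
Proof.
have [m] := ubnP (\sum_k l k)%N; elim: m l => // m IHm l; rewrite ltnS => lm.
have [l0|] := posnP (\sum_k l k)%N; last first.
  rewrite lt0n sum_nat_eq0 negb_forall => /existsP[k]; rewrite implyTb -lt0n => lk.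
  pose l' := [ffun j => (l j - (j == k))%N].
  have ll' : l = incr k l'.
    by apply/ffunP => j; rewrite !ffunE subnK //; case: eqP => // ->.
  have l'm : (\sum_j l' j < m)%N.
    apply: leq_trans lm; rewrite (bigD1 k) //= [ltnRHS](bigD1 k) //=.
    rewrite -addSn leq_add //; first by rewrite ffunE eqxx subn1 prednK.
    by apply: leq_sum => j _; rewrite ffunE leq_subr.
  have l1 : (l' k).+1%:R != 0 :> R by rewrite pnatr_eq0.
  apply: (mulfI l1); rewrite ll' sum_grouped_incr IHm //.
  by rewrite -poisson_weight_incr !ffunE eqxx addn1.
have lE k : l k = 0%N.
  by apply/eqP; move/eqP: l0; rewrite sum_nat_eq0 => /forallP/(_ k).
rewrite (_ : grouped l = [set [ffun=> 0%N]]); last first.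
  apply/seteqP; split => [f lf|_ -> k]; last first.
    by rewrite lE big1 // => i _; rewrite ffunE.
  apply/ffunP => i; rewrite ffunE; apply/eqP; rewrite -leqn0.
  by rewrite -(lE (kappa i)) -(lf (kappa i)) (bigD1 i) //= leq_addr.
rewrite fsbig_set1 /poisson_weight !big1 // => i _; last by rewrite ffunE expr0 divr1.
by rewrite lE expr0 divr1.
Qed.

End Grouping.

Section Multinomial.
Variables (R : realType) (I : finType).

(** The case of [sum_grouped] in which all indices are merged into one. *)
Lemma multinomial_theorem (x : I -> R) m :
  \sum_(f \in [set f : {ffun I -> nat} | (\sum_i f i = m)%N])
     poisson_weight x f = (\sum_i x i) ^+ m / m`!%:R.
Proof.
have := sum_grouped (fun=> tt) x [ffun=> m].
rewrite [X in _ = X]/poisson_weight (big_pred1 tt) => [|[]//]; rewrite ffunE => <-.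
apply: eq_fsbigl; apply/seteqP; split => f /=; first by move=> fm k; rewrite ffunE.
by move/(_ tt); rewrite ffunE.
Qed.

End Multinomial.

(** * Normalization of the Ewens sampling formula *)

Section Ewens.
Variables (R : realType) (n : nat) (theta : R).

(** Only parts of size at most n are available, so these are all the
    partitions of m as long as m <= n. *)
Definition partition_set m : set {ffun 'I_n -> nat} :=
  [set l | (\sum_(i < n) i.+1 * l i = m)%N].

Lemma finite_partition_set m : finite_set (partition_set m).
Proof.
apply: (@finite_bounded _ _ m) => l i <-.
by rewrite (bigD1 i) //= mulSn -addnA leq_addr.
Qed.

Lemma partition_set_incr m (i : 'I_n) :
  [set l | partition_set m (incr i l)] =
  if (i < m)%N then partition_set (m - i.+1) else set0.
Proof.
have E l : (\sum_(j < n) j.+1 * incr i l j = \sum_(j < n) j.+1 * l j + i.+1)%N.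
  under eq_bigr do rewrite ffunE mulnDr.
  rewrite big_split /=; congr (_ + _)%N.
  rewrite (bigD1 i) //= eqxx muln1 big1 ?addn0 // => j /negPf ->.
  by rewrite muln0.
apply/seteqP; split => l; rewrite /partition_set /= E.
  by move=> <-; rewrite addnK ltn_addl.
by case: ifP => //= im ->; rewrite subnK.
Qed.

Let partition_sum m : R :=
  \sum_(l \in partition_set m) poisson_weight (fun i : 'I_n => theta / i.+1%:R) l.

(** The statistic is the size m itself; its coefficient i.+1 cancels the
    denominator of the mean theta / i.+1, so every smaller size enters with the
    same factor theta. *)
Let partition_sum_rec m : (m <= n)%N ->
  m%:R * partition_sum m = theta * \sum_(i < m) partition_sum i.
Proof.
move=> mn; rewrite /partition_sum mulr_fsumr.
transitivity (\sum_(l \in partition_set m) ((\sum_(i < n) i.+1 * l i)%N%:R *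
    poisson_weight (fun i : 'I_n => theta / i.+1%:R) l)).
  by apply: eq_fsbigr => l; rewrite inE => ->.
rewrite (sum_linear_multiplicity _ (fun i : 'I_n => i.+1)); last first.
  exact: finite_partition_set.
transitivity (\sum_(i < n | (i < m)%N) theta * partition_sum (m - i.+1)).
  rewrite [RHS]big_mkcond; apply: eq_bigr => i _.
  rewrite partition_set_incr mulrCA mulfV ?pnatr_eq0 // mulr1.
  by case: ifP => // _; rewrite fsbig_set0 mulr0.
rewrite -(big_ord_widen n (fun i => theta * partition_sum (m - i.+1))) //.
rewrite mulr_sumr (reindex_inj rev_ord_inj) /=.
by apply: eq_bigr => i _; rewrite subnS subKn //= prednK.
Qed.

(** Subtracting two consecutive instances of the recursion for the weights c_m
    leaves (m + 1) c_(m+1) = (m + theta) c_m. *)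
Lemma sum_partition_weight m : (m <= n)%N ->
  \sum_(l \in partition_set m) poisson_weight (fun i : 'I_n => theta / i.+1%:R) l =
  rising theta m / m`!%:R.
Proof.
rewrite -/(partition_sum m); elim: m => [_|m IHm mn].
  rewrite /partition_sum /rising big_ord0 divr1 (_ : partition_set 0 = [set [ffun=> 0%N]]).
    rewrite fsbig_set1 /poisson_weight big1 // => i _.
    by rewrite ffunE expr0 divr1.
  apply/seteqP; split => [l /= /eqP|_ -> /=]; last first.
    by rewrite /partition_set /= big1 // => i _; rewrite ffunE muln0.
  rewrite sum_nat_eq0 => /forallP l0; apply/ffunP => i; rewrite ffunE.
  by apply/eqP; have := l0 i; rewrite muln_eq0.
have m1 : m.+1%:R != 0 :> R by rewrite pnatr_eq0.
have m0 : m`!%:R != 0 :> R by rewrite pnatr_eq0 -lt0n fact_gt0.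
apply: (mulfI m1); rewrite partition_sum_rec // big_ord_recr /= mulrDr.
rewrite -partition_sum_rec 1?ltnW // -mulrDl IHm 1?ltnW //.
by rewrite /rising big_ord_recr /= factS natrM; field; rewrite m0 nat1r m1.
Qed.

End Ewens.

(** * Moments of a probability measure on the simplex *)

Lemma finite_weight_eq q m : finite_set [set a : multi_index q | weight a = m].
Proof.
apply: (@finite_bounded _ _ m) => a i <-.
by rewrite /weight (bigD1 i) //= leq_addr.
Qed.

Section Moments.
Variables (R : realType) (q : nat) (q_gt0 : (0 < q)%N).
Variable nu : probability (borel_simplex R q_gt0) R.
Implicit Types (a : multi_index q) (u : borel_simplex R q_gt0).

Let monomial a u : R := \prod_j (val u) 0 j ^+ a j.

Lemma simplex_coord_ge0 u j : 0 <= (val u) 0 j.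
Proof. by have /set_mem[/(_ j)/andP[]] := valP u. Qed.

Lemma simplex_coord_le1 u j : (val u) 0 j <= 1.
Proof. by have /set_mem[/(_ j)/andP[]] := valP u. Qed.

Lemma simplex_coord_sum u : \sum_j (val u) 0 j = 1.
Proof. by have /set_mem[] := valP u. Qed.

(** Coordinates are continuous for the induced topology, hence Borel. *)
Lemma measurable_simplex_coord j :
  measurable_fun [set: borel_simplex R q_gt0] (fun u => (val u) 0 j).
Proof.
apply: (measurability _ (RGenOpens.measurableE R)) => _ [_ [x [y ->] <-]].
rewrite setTI; apply: sub_sigma_algebra.
have := interval_open; move/(_ R (BRight x) (BLeft y) isT isT).
move: `]x, y[%classic => U oU.
exists ((fun v : 'rV[R]_q => v 0 j) @^-1` U) => //.
by apply: open_comp => // v _; exact: coord_continuous.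
Qed.

Let measurable_monomial a : measurable_fun setT (monomial a).
Proof.
apply: measurable_prod => j _; apply: measurable_funX.
exact: measurable_simplex_coord.
Qed.

Let monomial_ge0 a u : 0 <= monomial a u.
Proof. by apply: prodr_ge0 => j _; rewrite exprn_ge0 ?simplex_coord_ge0. Qed.

Let monomial_le1 a u : monomial a u <= 1.
Proof.
apply: prodr_ile1 => j _.
by rewrite exprn_ge0 ?exprn_ile1 ?simplex_coord_ge0 ?simplex_coord_le1.
Qed.

(** Monomials are bounded on the simplex, so the moments are finite and no
    information is lost in the real-valued integral. *)
Lemma moment_EFin a :
  (moment nu a)%:E = (\int[nu]_(u in setT) (\prod_j (val u) 0 j ^+ a j)%:E)%E.
Proof.
rewrite /moment /Rintegral fineK //; apply: integrable_fin_num => //.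
apply: (@measurable_bounded_integrable _ _ _ _ (monomial a)) => //.
  by have := ltry (1 : R); rewrite -(@probability_setT _ _ _ nu).
exists 1; split=> // M M1 u _ /=.
by rewrite ger0_norm ?monomial_ge0 // (le_trans (monomial_le1 a u)) ?ltW.
Qed.

Lemma moment_ge0 a : 0 <= moment nu a.
Proof.
rewrite -lee_fin moment_EFin; apply: integral_ge0 => u _.
by rewrite lee_fin monomial_ge0.
Qed.

Lemma multinomial_ge0 a : 0 <= multinomial R a.
Proof. by rewrite divr_ge0 ?ler0n // -natr_prod ler0n. Qed.

(** Inside the integral the multinomial theorem turns the sum into
    (sum_j u_j)^m, which is 1 on the simplex, and nu has mass 1. *)
Lemma sum_moments m :
  \sum_(a \in [set a : multi_index q | weight a = m])
    multinomial R a * moment nu a = 1.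
Proof.
apply: EFin_inj; rewrite -fsumEFin; last exact: finite_weight_eq.
transitivity (\sum_(a \in [set a : multi_index q | weight a = m])
    \int[nu]_(u in setT) (multinomial R a * monomial a u)%:E)%E.
  apply: eq_fsbigr => a _; rewrite EFinM moment_EFin -ge0_integralZl_EFin //.
  - by move=> u _; rewrite lee_fin monomial_ge0.
  - by apply/measurable_EFinP; exact: measurable_monomial.
  - exact: multinomial_ge0.
rewrite -ge0_integral_fsum //; first last.
- exact: finite_weight_eq.
- by move=> a u _; rewrite lee_fin mulr_ge0 ?multinomial_ge0 ?monomial_ge0.
- move=> a; apply/measurable_EFinP; apply: measurable_funM => //.
rewrite (eq_integral (cst 1%E)).
  by rewrite integral_cst // mul1e; exact: probability_setT.
move=> u _; rewrite fsumEFin; last exact: finite_weight_eq.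
congr EFin; rewrite /=.
transitivity (m`!%:R * \sum_(a \in [set a : multi_index q | weight a = m])
    poisson_weight (val u 0) a).
  rewrite mulr_fsumr; apply: eq_fsbigr => a; rewrite inE => /= <-.
  rewrite /poisson_weight big_split /= prodfV [RHS]mulrA.
  by rewrite /multinomial mulrAC.
by rewrite multinomial_theorem simplex_coord_sum expr1n mul1r divff.
Qed.

End Moments.

(** * Chromatic partitions as multiplicities over a finite index set *)

Section FiniteSupport.
Variables (q n : nat).

(** A chromatic partition of n is supported on indices of weight at most n,
    which makes it a function on this finite set. *)
Definition light_indices : {fset nz_multi_index q} :=
  fset_set [set a : nz_multi_index q | (weight (val a) <= n)%N].

Lemma finite_light_indices :
  finite_set [set a : nz_multi_index q | (weight (val a) <= n)%N].
Proof.
apply: (@finite_preimage _ _ [set a : multi_index q | (weight a <= n)%N] val).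
  by move=> a b _ _; exact: val_inj.
apply: (@finite_bounded _ _ n) => a i; apply: leq_trans.
by rewrite /weight (bigD1 i) //= leq_addr.
Qed.

Lemma in_light_indices a : (a \in light_indices) = (weight (val a) <= n)%N.
Proof.
by rewrite in_fset_set ?mem_setE //; exact: finite_light_indices.
Qed.

Lemma light_index_bound (a : light_indices) :
  ((weight (val (val a))).-1 < n)%N.
Proof.
by rewrite prednK ?weight_gt0 // -in_light_indices; exact: valP.
Qed.

Definition part_size (a : light_indices) : 'I_n := Ordinal (light_index_bound a).

Lemma part_sizeE (a : light_indices) i :
  (part_size a == i) = (weight (val (val a)) == i.+1).
Proof. by rewrite -val_eqE /= -eqSS prednK ?weight_gt0. Qed.

Lemma sum_light_indices (R : realType) (F : multi_index q -> R) (i : 'I_n) :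
  \sum_(a | part_size a == i) F (val (val a)) =
  \sum_(a \in [set a : multi_index q | weight a = i.+1]) F a.
Proof.
rewrite -big_filter fsbig_seq; last by rewrite filter_uniq ?index_enum_uniq.
apply/esym; apply: (@reindex_fsbig _ _ _ _ _ (fun a => val (val a))).
split=> [a /=|a b _ _ /val_inj/val_inj //|a /= ai].
  by rewrite mem_filter part_sizeE => /andP[/eqP].
have a0 : a != [ffun=> 0%N].
  apply/eqP => a0; move: ai; rewrite /weight a0.
  by under eq_bigr do rewrite ffunE; rewrite big1.
pose b : nz_multi_index q := Sub a a0.
have bn : b \in light_indices by rewrite in_light_indices /= ai.
exists [` bn]%fset => //=.
by rewrite mem_filter part_sizeE mem_index_enum /= ai eqxx.
Qed.

Lemma finsupp_light (A : chromatic_map q) : chromatic_total A = n ->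
  (finsupp A `<=` light_indices)%fset.
Proof.
move=> An; apply/fsubsetP => a aA; rewrite in_light_indices -An.
rewrite /chromatic_total (big_fsetD1 a) //= (leq_trans _ (leq_addr _ _)) //.
by rewrite leq_pmull // lt0n -mem_finsupp.
Qed.

Lemma big_finsupp_light (T : Type) (idx : T) (op : Monoid.com_law idx)
    (A : chromatic_map q) (P : pred (nz_multi_index q)) (F : nz_multi_index q -> T) :
  (finsupp A `<=` light_indices)%fset -> (forall a, A a = 0%N -> F a = idx) ->
  \big[op/idx]_(a <- finsupp A | P a) F a =
  \big[op/idx]_(a : light_indices | P (val a)) F (val a).
Proof.
move=> An F0; rewrite -big_seq_fsetE /= big_mkcond [RHS]big_mkcond.
apply: big_fset_incl => // a _; rewrite memNfinsupp => /eqP /F0 ->.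
by case: ifP.
Qed.

Definition multiplicities (A : chromatic_map q) : {ffun light_indices -> nat} :=
  [ffun a => A (val a)].

End FiniteSupport.

Section Shape.
Variables (q n : nat).

Let S := light_indices q n.

(** Shape becomes merging along [part_size].  That a family of multiplicities
    merging to l comes from a partition of n is automatic: its total weight
    depends on l only. *)
Lemma set_bij_multiplicities (l : int_partition n) :
  set_bij (@chromatic_shape q n @^-1` [set l])
    (grouped (@part_size q n) (val l))
    (fun A : chromatic_partition q n => multiplicities n (val A)).
Proof.
have shapeE (A : chromatic_map q) (i : 'I_n) : (finsupp A `<=` S)%fset ->
    shape_fun n A i = (\sum_(a | part_size a == i) multiplicities n A a)%N.
  move=> AS; rewrite ffunE (big_finsupp_light _ _ AS) //.
  by apply: eq_big => [a|a _]; rewrite ?part_sizeE ?ffunE.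
split=> [A /= <- i|A B _ _ AB|f lf].
- by rewrite -shapeE //; exact: finsupp_light (eqP (valP A)).
- apply/val_inj/fsfunP => a.
  have [aS|aS] := boolP (a \in S).
    by move/ffunP/(_ [` aS]%fset): AB; rewrite !ffunE.
  have out (C : chromatic_partition q n) : val C a = 0%N.
    apply/eqP; rewrite -memNfinsupp; apply: contra aS.
    exact: (fsubsetP (finsupp_light (eqP (valP C)))).
  by rewrite !out.
pose A : chromatic_map q := [fsfun a : S => f a | 0%N]%fsfun.
have AS : (finsupp A `<=` S)%fset by exact: finsupp_sub.
have Af : multiplicities n A = f.
  by apply/ffunP => a; rewrite ffunE /A fsfun_ffun valK.
have An : chromatic_total A == n.
  rewrite /chromatic_total (big_finsupp_light _ _ AS); last by move=> a ->.
  rewrite (partition_big (@part_size q n) xpredT) //= -[X in _ == X](eqP (valP l)).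
  apply/eqP; apply: eq_bigr => i _; rewrite -lf big_distrr /=.
  apply: eq_bigr => a; rewrite part_sizeE => /eqP ->.
  by rewrite -Af ffunE mulnC.
exists (Sub A An) => //=; apply/val_inj/ffunP => i /=.
by rewrite shapeE // Af lf.
Qed.

End Shape.

(** * The polychromatic Ewens sampling formula and its shape *)

Section Distribution.
Variables (R : realType) (n q : nat) (q_gt0 : (0 < q)%N).
Variables (theta : R) (nu : probability (borel_simplex R q_gt0) R).

Let S := light_indices q n.

Let color_weight (a : multi_index q) : R :=
  theta / (weight a)%:R * multinomial R a * moment nu a.

Lemma ESF_poisson_weight (l : int_partition n) :
  ESF n theta l =
  n`!%:R / rising theta n * poisson_weight (fun i : 'I_n => theta / i.+1%:R) (val l).
Proof.
congr (_ * _); apply: eq_bigr => i _.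
by rewrite expr_div_n invfM mulrA.
Qed.

Lemma polyESF_poisson_weight (A : chromatic_partition q n) :
  polyESF n theta nu A =
  n`!%:R / rising theta n *
  poisson_weight (fun a : S => color_weight (val (val a))) (multiplicities n (val A)).
Proof.
rewrite /polyESF (big_finsupp_light _ _ (finsupp_light (eqP (valP A)))); last first.
  by move=> a ->; rewrite expr0 invr1 mulr1.
by congr (_ * _); apply: eq_bigr => a _; rewrite ffunE mulrC.
Qed.

Lemma sum_color_weight (i : 'I_n) :
  \sum_(a : S | part_size a == i) color_weight (val (val a)) = theta / i.+1%:R.
Proof.
rewrite sum_light_indices.
transitivity (theta / i.+1%:R * \sum_(a \in [set a : multi_index q | weight a = i.+1])
    multinomial R a * moment nu a); last by rewrite sum_moments mulr1.
rewrite mulr_fsumr; apply: eq_fsbigr => a; rewrite inE /color_weight => /= ->.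
by rewrite -mulrA.
Qed.

Hypothesis theta_gt0 : 0 < theta.

Lemma rising_gt0 : 0 < rising theta n.
Proof. by apply: prodr_gt0 => i _; rewrite ltr_wpDr. Qed.

Lemma color_weight_ge0 a : 0 <= color_weight a.
Proof.
rewrite mulr_ge0 ?moment_ge0 // mulr_ge0 ?multinomial_ge0 // divr_ge0 ?ler0n //.
exact: ltW.
Qed.

Lemma polyESF_ge0 (A : chromatic_partition q n) : 0 <= polyESF n theta nu A.
Proof.
rewrite polyESF_poisson_weight mulr_ge0 ?divr_ge0 ?ler0n ?(ltW rising_gt0) //.
by apply: poisson_weight_ge0 => a; exact: color_weight_ge0.
Qed.

Lemma mass_shape_fiber (l : int_partition n) :
  mass_measure (polyESF n theta nu) (@chromatic_shape q n @^-1` [set l]) =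
  (ESF n theta l)%:E.
Proof.
pose w := poisson_weight (fun a : S => color_weight (val (val a))).
rewrite /mass_measure; under eq_esum do rewrite polyESF_poisson_weight.
rewrite -(@reindex_esum _ _ _ _ _ _ (fun f => (n`!%:R / rising theta n * w f)%:E)
  (set_bij_multiplicities q l)).
rewrite esum_fset; first last.
- move=> f _; rewrite lee_fin mulr_ge0 ?divr_ge0 ?ler0n ?(ltW rising_gt0) //.
  by apply: poisson_weight_ge0 => a; exact: color_weight_ge0.
- exact: finite_grouped.
rewrite fsumEFin; last exact: finite_grouped.
rewrite -mulr_fsumr sum_grouped ESF_poisson_weight; congr ((_ * _)%:E).
by apply: eq_bigr => i _; rewrite sum_color_weight.
Qed.

Lemma ESF_total : mass_measure (ESF n theta) setT = 1%E.
Proof.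
pose w := poisson_weight (fun i : 'I_n => theta / i.+1%:R).
have bij : set_bij [set: int_partition n] (partition_set n) val.
  split=> [l _|l l' _ _ /val_inj //|l /= ln]; first exact: (eqP (valP l)).
  by exists (Sub l (introT eqP ln)).
rewrite /mass_measure; under eq_esum do rewrite ESF_poisson_weight.
rewrite -(@reindex_esum _ _ _ _ _ _ (fun f => (n`!%:R / rising theta n * w f)%:E) bij).
rewrite esum_fset; first last.
- move=> l _; rewrite lee_fin mulr_ge0 ?divr_ge0 ?ler0n ?(ltW rising_gt0) //.
  by apply: poisson_weight_ge0 => i; rewrite divr_ge0 ?ler0n ?ltW.
- exact: finite_partition_set.
rewrite fsumEFin; last exact: finite_partition_set.
rewrite -mulr_fsumr sum_partition_weight //.
have r0 : rising theta n != 0 by rewrite gt_eqF ?rising_gt0.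
have f0 : n`!%:R != 0 :> R by rewrite pnatr_eq0 -lt0n fact_gt0.
by congr EFin; field; rewrite r0 f0.
Qed.

(** Fubini over the fibers of the shape map, one fiber for each point of B. *)
Lemma mass_shape_preimage (B : set (int_partition n)) :
  mass_measure (polyESF n theta nu) (@chromatic_shape q n @^-1` B) =
  mass_measure (ESF n theta) B.
Proof.
rewrite [RHS]/mass_measure; under eq_esum do rewrite -mass_shape_fiber.
rewrite /mass_measure esum_esum => [|l A _ _]; last by rewrite lee_fin polyESF_ge0.
apply/esym; apply: (@reindex_esum _ _ _ _ _
  (fun A : chromatic_partition q n => (chromatic_shape A, A))
  (fun lA => (polyESF n theta nu lA.2)%:E)).
split=> [A BA|A A' _ _ []//|[l A] [/= Bl Al]]; first by split.
by exists A; rewrite /= Al.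
Qed.

End Distribution.

Theorem proposition4p4 (R : realType) (n q : nat) (q_gt0 : (0 < q)%N)
    (theta : R) (theta_gt0 : 0 < theta)
    (nu : probability (borel_simplex R q_gt0) R) :
  is_distribution (polyESF n theta nu) /\
  (forall B : set (int_partition n),
     mass_measure (polyESF n theta nu)
       (@chromatic_shape q n @^-1` B) =
     mass_measure (ESF n theta) B).
Proof.
have shapeE := mass_shape_preimage nu theta_gt0.
split; last exact: shapeE.
split; first by move=> A; exact: polyESF_ge0.
by rewrite -(preimage_setT (@chromatic_shape q n)) shapeE ESF_total.
Qed.
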